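(* Let $\mathbf{H}=(H,m,e,\delta,\varepsilon,\lambda)$ be a bimonad on a category $\mathbb{A}$. (1) The following are equivalent: (a) $\gamma=Hm\cdot\delta H:HH\to HH$ is an isomorphism; (b) $\gamma'=mH\cdot H\delta:HH\to HH$ is an isomorphism; (c) $\mathbf{H}$ has an antipode. (2) If $\mathbf{H}$ has an antipode and $\mathbb{A}$ admits equalisers, then the comparison functor $K_{\underline H}:\mathbb{A}\to\mathbb{A}^{\overline H}_{\underline H}(\lambda)$, $a\mapsto(H(a),m_a,\delta_a)$, makes $\mathbb{A}$ (isomorphic to) a coreflective subcategory of the category $\mathbb{A}^{\overline H}_{\underline H}(\lambda)$.
   Context: Composition of functors is written by juxtaposition, $\cdot$ is vertical composition of natural transformations, and $H\alpha$, $\alpha H$ denote whiskerings. A bimonad $\mathbf{H}=(H,m,e,\delta,\varepsilon,\lambda)$ on a category $\mathbb{A}$ is an endofunctor $H:\mathbb{A}\to\mathbb{A}$ with a monad structure $\underline H=(H,m:HH\to H,e:1\to H)$, a comonad structure $\overline H=(H,\delta:H\to HH,\varepsilon:H\to 1)$ and a natural transformation $\lambda:HH\to HH$ such that: (i) $\varepsilon\cdot e=1$ and $\varepsilon\cdot m=\varepsilon\cdot H\varepsilon$; (ii) $\delta\cdot e=eH\cdot e$; (iii) $\lambda$ is a mixed distributive law (entwining) from the monad $\underline H$ to the comonad $\overline H$, i.e. $\lambda\cdot eH=He$, $\varepsilon H\cdot\lambda=H\varepsilon$, $\delta H\cdot\lambda=H\lambda\cdot\lambda H\cdot H\delta$,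 $\lambda\cdot mH=Hm\cdot\lambda H\cdot H\lambda$; and $\delta\cdot m=Hm\cdot\lambda H\cdot H\delta$. An antipode is a natural transformation $S:H\to H$ with $m\cdot SH\cdot\delta=e\cdot\varepsilon=m\cdot HS\cdot\delta$. $\mathbb{A}^{\overline H}_{\underline H}(\lambda)$ is the category of triples $(a,h_a,\theta_a)$ where $(a,h_a:H(a)\to a)$ is an $\underline H$-module (Eilenberg–Moore algebra), $(a,\theta_a:a\to H(a))$ is an $\overline H$-comodule (Eilenberg–Moore coalgebra), and $\theta_a\cdot h_a=H(h_a)\cdot\lambda_a\cdot H(\theta_a)$; morphisms are morphisms of $\mathbb{A}$ that are both module and comodule morphisms. On morphisms $K_{\underline H}$ is $f\mapsto H(f)$. A functor makes its domain (isomorphic to) a coreflective subcategory of its codomain if it is fully faithful and has a right adjoint. *)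

(* Defs.v *)
From Stdlib Require Import ProofIrrelevance.

Set Implicit Arguments.
Unset Strict Implicit.
Unset Printing Implicit Defensive.

Declare Scope cat_scope.
Delimit Scope cat_scope with cat.
Open Scope cat_scope.

Record Category : Type := {
  ob :> Type;
  hom : ob -> ob -> Type;
  idm : forall a, hom a a;
  comp : forall a b c, hom b c -> hom a b -> hom a c;
  comp_idl : forall a b (f : hom a b), comp (idm b) f = f;
  comp_idr : forall a b (f : hom a b), comp f (idm a) = f;
  comp_assoc : forall a b c d (h : hom c d) (g : hom b c) (f : hom a b),
    comp h (comp g f) = comp (comp h g) f
}.
Arguments hom {C} a b : rename.
Arguments idm {C} a : rename.
Arguments comp {C a b c} g f : rename.

Notation "g ∘ f" := (comp g f) (at level 40, left associativity) : cat_scope.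

Record Functor (C D : Category) : Type := {
  fobj :> C -> D;
  fmap : forall a b, hom a b -> hom (fobj a) (fobj b);
  fmap_id : forall a, fmap (idm a) = idm (fobj a);
  fmap_comp : forall a b c (g : hom b c) (f : hom a b),
    fmap (g ∘ f) = fmap g ∘ fmap f
}.
Arguments fmap {C D} F {a b} f : rename.

Definition functor_id (C : Category) : Functor C C :=
  {| fobj := fun a => a;
     fmap := fun a b f => f;
     fmap_id := fun a => eq_refl;
     fmap_comp := fun a b c g f => eq_refl |}.

Program Definition functor_comp (C D E : Category)
    (G : Functor D E) (F : Functor C D) : Functor C E :=
  {| fobj := fun a => G (F a);
     fmap := fun a b f => fmap G (fmap F f) |}.
Next Obligation. intros; simpl; now rewrite !fmap_id. Qed.
Next Obligation. intros; simpl; now rewrite !fmap_comp. Qed.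

Record NatTrans (C D : Category) (F G : Functor C D) : Type := {
  component :> forall a, hom (F a) (G a);
  naturality : forall a b (f : hom a b),
    component b ∘ fmap F f = fmap G f ∘ component a
}.

(* Equations between natural transformations are stated componentwise
   throughout: (Hα)_a is [fmap H (α a)] and (αH)_a is [α (H a)].  This avoids
   the associators that would mediate between (HH)H and H(HH), which are not
   convertible as records. *)

Definition is_natural_iso (C D : Category) (F G : Functor C D)
    (tau : NatTrans F G) : Prop :=
  exists sigma : NatTrans G F,
    (forall a, sigma a ∘ tau a = idm (F a)) /\
    (forall a, tau a ∘ sigma a = idm (G a)).

Record adjunction (C D : Category) (L : Functor C D) (R : Functor D C) : Type := {
  adj_unit : NatTrans (functor_id C) (functor_comp R L);
  adj_counit : NatTrans (functor_comp L R) (functor_id D);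
  adj_triangle_left : forall c : C,
    adj_counit (L c) ∘ fmap L (adj_unit c) = idm (L c);
  adj_triangle_right : forall d : D,
    fmap R (adj_counit d) ∘ adj_unit (R d) = idm (R d)
}.

Definition has_right_adjoint (C D : Category) (L : Functor C D) : Prop :=
  exists R : Functor D C, inhabited (adjunction L R).

Definition fully_faithful (C D : Category) (F : Functor C D) : Prop :=
  forall (a b : C) (g : hom (F a) (F b)), exists! f : hom a b, fmap F f = g.

Definition makes_coreflective (C D : Category) (F : Functor C D) : Prop :=
  fully_faithful F /\ has_right_adjoint F.

Definition is_equaliser (C : Category) (a b : C) (f g : hom a b)
    (q : C) (i : hom q a) : Prop :=
  f ∘ i = g ∘ i /\
  forall (c : C) (x : hom c a), f ∘ x = g ∘ x ->
    exists! y : hom c q, i ∘ y = x.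

Definition has_equalisers (C : Category) : Prop :=
  forall (a b : C) (f g : hom a b),
    exists (q : C) (i : hom q a), is_equaliser f g i.

Record MonadStructure (A : Category) (H : Functor A A) : Type := {
  mult : NatTrans (functor_comp H H) H;
  unit : NatTrans (functor_id A) H;
  mult_assoc : forall a, mult a ∘ mult (H a) = mult a ∘ fmap H (mult a);
  mult_unit_l : forall a, mult a ∘ unit (H a) = idm (H a);
  mult_unit_r : forall a, mult a ∘ fmap H (unit a) = idm (H a)
}.

Record ComonadStructure (A : Category) (H : Functor A A) : Type := {
  comult : NatTrans H (functor_comp H H);
  counit : NatTrans H (functor_id A);
  comult_coassoc : forall a,
    comult (H a) ∘ comult a = fmap H (comult a) ∘ comult a;
  comult_counit_l : forall a, counit (H a) ∘ comult a = idm (H a);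
  comult_counit_r : forall a, fmap H (counit a) ∘ comult a = idm (H a)
}.

Record is_entwining (A : Category) (H : Functor A A)
    (M : MonadStructure H) (W : ComonadStructure H)
    (lam : NatTrans (functor_comp H H) (functor_comp H H)) : Prop := {
  entwining_unit : forall a, lam a ∘ unit M (H a) = fmap H (unit M a);
  entwining_counit : forall a, counit W (H a) ∘ lam a = fmap H (counit W a);
  entwining_comult : forall a,
    comult W (H a) ∘ lam a
    = fmap H (lam a) ∘ lam (H a) ∘ fmap H (comult W a);
  entwining_mult : forall a,
    lam a ∘ mult M (H a)
    = fmap H (mult M a) ∘ lam (H a) ∘ fmap H (lam a)
}.

Record Bimonad (A : Category) : Type := {
  bfun :> Functor A A;
  bmonad : MonadStructure bfun;
  bcomonad : ComonadStructure bfun;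
  blam : NatTrans (functor_comp bfun bfun) (functor_comp bfun bfun);
  bimonad_counit_unit : forall a,
    counit bcomonad a ∘ unit bmonad a = idm a;
  bimonad_counit_mult : forall a,
    counit bcomonad a ∘ mult bmonad a
    = counit bcomonad a ∘ fmap bfun (counit bcomonad a);
  bimonad_comult_unit : forall a,
    comult bcomonad a ∘ unit bmonad a = unit bmonad (bfun a) ∘ unit bmonad a;
  bimonad_entwining : is_entwining bmonad bcomonad blam;
  bimonad_comult_mult : forall a,
    comult bcomonad a ∘ mult bmonad a
    = fmap bfun (mult bmonad a) ∘ blam (bfun a) ∘ fmap bfun (comult bcomonad a)
}.

Section BimonadNotions.
Variables (A : Category) (H : Bimonad A).

Let m := mult (bmonad H).
Let e := unit (bmonad H).
Let δ := comult (bcomonad H).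
Let ε := counit (bcomonad H).

Definition is_antipode (S : NatTrans H H) : Prop :=
  (forall a, m a ∘ S (H a) ∘ δ a = e a ∘ ε a) /\
  (forall a, m a ∘ fmap H (S a) ∘ δ a = e a ∘ ε a).

Definition has_antipode : Prop := exists S : NatTrans H H, is_antipode S.

Program Definition gamma : NatTrans (functor_comp H H) (functor_comp H H) :=
  {| component := fun a => fmap H (m a) ∘ δ (H a) |}.
Next Obligation.
intros a b f; simpl.
rewrite <- comp_assoc.
pose proof (naturality δ (fmap H f)) as E; simpl in E; rewrite E; clear E.
rewrite !comp_assoc, <- !fmap_comp.
pose proof (naturality m f) as E; simpl in E; rewrite E.
reflexivity.
Qed.

Program Definition gamma' : NatTrans (functor_comp H H) (functor_comp H H) :=
  {| component := fun a => m (H a) ∘ fmap H (δ a) |}.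
Next Obligation.
intros a b f; simpl.
rewrite <- comp_assoc, <- fmap_comp.
pose proof (naturality δ f) as E; simpl in E; rewrite E; clear E.
rewrite fmap_comp, !comp_assoc.
pose proof (naturality m (fmap H f)) as E; simpl in E; rewrite E.
reflexivity.
Qed.

Record MixedModule : Type := {
  carrier :> A;
  action : hom (H carrier) carrier;
  coaction : hom carrier (H carrier);
  action_assoc : action ∘ m carrier = action ∘ fmap H action;
  action_unit : action ∘ e carrier = idm carrier;
  coaction_coassoc : δ carrier ∘ coaction = fmap H coaction ∘ coaction;
  coaction_counit : ε carrier ∘ coaction = idm carrier;
  mixed_compat :
    coaction ∘ action
    = fmap H action ∘ blam H carrier ∘ fmap H coaction
}.

Record MixedHom (a b : MixedModule) : Type := {
  underlying :> hom (carrier a) (carrier b);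
  underlying_action : underlying ∘ action a = action b ∘ fmap H underlying;
  underlying_coaction : coaction b ∘ underlying = fmap H underlying ∘ coaction a
}.

Lemma mixed_hom_eq (a b : MixedModule) (f g : MixedHom a b) :
  underlying f = underlying g -> f = g.
Proof.
destruct f as [f f1 f2], g as [g g1 g2]; simpl; intros <-.
now rewrite (proof_irrelevance _ f1 g1), (proof_irrelevance _ f2 g2).
Qed.

Program Definition mixed_id (a : MixedModule) : MixedHom a a :=
  {| underlying := idm (carrier a) |}.
Next Obligation. now intros a; rewrite fmap_id, comp_idl, comp_idr. Qed.
Next Obligation. now intros a; rewrite fmap_id, comp_idl, comp_idr. Qed.

Program Definition mixed_comp (a b c : MixedModule)
    (g : MixedHom b c) (f : MixedHom a b) : MixedHom a c :=
  {| underlying := underlying g ∘ underlying f |}.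
Next Obligation.
intros a b c g f.
now rewrite fmap_comp, <- comp_assoc, underlying_action, !comp_assoc,
  underlying_action.
Qed.
Next Obligation.
intros a b c g f.
now rewrite fmap_comp, comp_assoc, underlying_coaction, <- !comp_assoc,
  underlying_coaction.
Qed.

Program Definition MixedModules : Category :=
  {| ob := MixedModule; hom := MixedHom;
     idm := mixed_id; comp := mixed_comp |}.
Next Obligation. intros; apply mixed_hom_eq, comp_idl. Qed.
Next Obligation. intros; apply mixed_hom_eq, comp_idr. Qed.
Next Obligation. intros; apply mixed_hom_eq, comp_assoc. Qed.

Definition comparison_ob (a : A) : MixedModule :=
  {| carrier := H a;
     action := m a;
     coaction := δ a;
     action_assoc := mult_assoc (bmonad H) a;
     action_unit := mult_unit_l (bmonad H) a;
     coaction_coassoc := comult_coassoc (bcomonad H) a;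
     coaction_counit := comult_counit_l (bcomonad H) a;
     mixed_compat := bimonad_comult_mult H a |}.

Definition comparison_hom (a b : A) (f : hom a b) :
    MixedHom (comparison_ob a) (comparison_ob b) :=
  @Build_MixedHom (comparison_ob a) (comparison_ob b) (fmap H f)
    (eq_sym (naturality m f)) (naturality δ f).

Program Definition comparison : Functor A MixedModules :=
  {| fobj := comparison_ob : A -> MixedModules;
     fmap := comparison_hom |}.
Next Obligation. intros; apply mixed_hom_eq, fmap_id. Qed.
Next Obligation. intros; apply mixed_hom_eq, fmap_comp. Qed.

End BimonadNotions.

(* Main.v *)
Require Import Defs.
From Stdlib Require Import IndefiniteDescription.

(** Think of [H] as [H ⊗ -] for a Hopf algebra, so that [γ] is
    [x ⊗ y ↦ x₁ ⊗ x₂ y] and [γ'] is [x ⊗ y ↦ x y₁ ⊗ y₂].  An antipode gives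
    the inverses [x ⊗ y ↦ x₁ ⊗ S(x₂) y] and [x ⊗ y ↦ x S(y₁) ⊗ y₂].
    Conversely [S] is read off from an inverse of [γ] as
    [x ↦ (ε ⊗ 1)(γ⁻¹(x ⊗ 1))], and from an inverse of [γ'] as
    [x ↦ (1 ⊗ ε)(γ'⁻¹(1 ⊗ x))].  The antipode equations hold because [γ] and
    [γ'], hence their inverses, commute with the multiplication on one side
    and the comultiplication on the other; see [antipode_of_gamma_iso] and
    [antipode_of_gamma'_iso].

    For the comparison functor [K], the point is that [e b] is the equaliser of
    [δ b] and [e (H b)], split by [ε b].  A morphism [g : K a -> K b] is
    determined by [g ∘ e a], because [H a] is free on [a] as a module.  As [g]
    is a comodule morphism, [g ∘ e a] equalises [δ b] and [e (H b)], so it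
    factors through [e b]: this gives full faithfulness.  For a mixed module [M], the
    morphisms [K a -> M] correspond in the same way to the morphisms from [a]
    that equalise the coaction of [M] and the unit, that is, to the morphisms
    from [a] to the object of coinvariants of [M].  That object is therefore
    the value at [M] of the right adjoint. *)

(** * Composites of morphisms *)

Lemma comp_prefix {C : Category} {x a b c : C} {g : hom b c} {f : hom a b}
    {k : hom a c} (E : g ∘ f = k) (t : hom x a) : g ∘ (f ∘ t) = k ∘ t.
Proof. now rewrite comp_assoc, E. Qed.

Lemma comp_prefix3 {C : Category} {x a b c d : C}
    {h : hom c d} {g : hom b c} {f : hom a b} {k : hom a d}
    (E : h ∘ (g ∘ f) = k) (t : hom x a) : h ∘ (g ∘ (f ∘ t)) = k ∘ t.
Proof. now rewrite <- E, <- !comp_assoc. Qed.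

Lemma fmap_eq {C D : Category} (F : Functor C D) {a b c : C}
    {g : hom b c} {f : hom a b} {k : hom a c} (E : g ∘ f = k) :
  fmap F g ∘ fmap F f = fmap F k.
Proof. now rewrite <- fmap_comp, E. Qed.

(* Both sides are kept as right-nested composites in which functors are
   applied to single factors; [rw E] replaces a segment of such a composite
   that matches the left-hand side of [E]. *)
Ltac nf := cbn; rewrite ?fmap_comp, <- ?comp_assoc, ?fmap_id, ?comp_idl, ?comp_idr.
Ltac rw E :=
  let K := fresh in
  pose proof E as K; cbn in K;
  rewrite ?fmap_comp, <- ?comp_assoc in K;
  first [rewrite K | rewrite (comp_prefix K) | rewrite (comp_prefix3 K)];
  clear K; nf.

Lemma inverse_intertwines {C : Category} {a b a' b' : C}
    {tau : hom a b} {sigma : hom b a} {tau' : hom a' b'} {sigma' : hom b' a'}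
    {u : hom a' a} {v : hom b' b}
    (E : sigma ∘ tau = idm a) (E' : tau' ∘ sigma' = idm b')
    (K : tau ∘ u = v ∘ tau') : sigma ∘ v = u ∘ sigma'.
Proof.
rewrite <- (comp_idr v), <- E', (comp_assoc v), <- K, !comp_assoc, E.
now rewrite comp_idl.
Qed.

Section Bimonads.
Context {A : Category} {H : Bimonad A}.

Local Notation m := (mult (bmonad H)).
Local Notation e := (unit (bmonad H)).
Local Notation δ := (comult (bcomonad H)).
Local Notation ε := (counit (bcomonad H)).
Local Notation λ := (blam H).

Lemma mult_natural {a b : A} (f : hom a b) :
  m b ∘ fmap H (fmap H f) = fmap H f ∘ m a.
Proof. exact (naturality m f). Qed.

Lemma unit_natural {a b : A} (f : hom a b) : e b ∘ f = fmap H f ∘ e a.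
Proof. exact (naturality e f). Qed.

Lemma comult_natural {a b : A} (f : hom a b) :
  δ b ∘ fmap H f = fmap H (fmap H f) ∘ δ a.
Proof. exact (naturality δ f). Qed.

Lemma counit_natural {a b : A} (f : hom a b) : ε b ∘ fmap H f = f ∘ ε a.
Proof. exact (naturality ε f). Qed.

(** * Antipodes and invertibility of the Galois maps *)

(** The inverse is [x ⊗ y ↦ x₁ ⊗ S(x₂) y].  In each composite with [γ],
    coassociativity and associativity bring together one of the two antipode
    equations, under [H]. *)
Lemma gamma_iso_of_antipode : has_antipode H -> is_natural_iso (gamma H).
Proof.
intros [S [SL SR]].
unshelve eexists.
- exists (fun a => fmap H (m a) ∘ fmap H (S (H a)) ∘ δ (H a)).
  intros a b f; nf.
  rw (comult_natural (fmap H f)).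
  rw (fmap_eq H (naturality S (fmap H f))).
  now rw (fmap_eq H (mult_natural f)).
- split; intros a; nf.
  + rw (comult_natural (m a)).
    rw (comult_coassoc (bcomonad H) (H a)).
    rw (fmap_eq H (naturality S (m a))).
    rw (fmap_eq H (eq_sym (mult_assoc (bmonad H) a))).
    rw (fmap_eq H (SL (H a))).
    rw (fmap_eq H (mult_unit_l (bmonad H) a)).
    now rw (comult_counit_r (bcomonad H) (H a)).
  + rw (comult_natural (m a)).
    rw (comult_natural (S (H a))).
    rw (comult_coassoc (bcomonad H) (H a)).
    rw (fmap_eq H (eq_sym (mult_assoc (bmonad H) a))).
    rw (fmap_eq H (SR (H a))).
    rw (fmap_eq H (mult_unit_l (bmonad H) a)).
    now rw (comult_counit_r (bcomonad H) (H a)).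
Qed.

(** The inverse is [x ⊗ y ↦ x S(y₁) ⊗ y₂]. *)
Lemma gamma'_iso_of_antipode : has_antipode H -> is_natural_iso (gamma' H).
Proof.
intros [S [SL SR]].
unshelve eexists.
- exists (fun a => m (H a) ∘ fmap H (S (H a)) ∘ fmap H (δ a)).
  intros a b f; nf.
  rw (fmap_eq H (comult_natural f)).
  rw (fmap_eq H (naturality S (fmap H f))).
  now rw (mult_natural (fmap H f)).
- split; intros a; nf.
  + rw (eq_sym (mult_natural (δ a))).
    rw (eq_sym (mult_natural (S (H a)))).
    rw (mult_assoc (bmonad H) (H a)).
    rw (fmap_eq H (eq_sym (comult_coassoc (bcomonad H) a))).
    rw (fmap_eq H (SR (H a))).
    rw (fmap_eq H (comult_counit_l (bcomonad H) a)).
    now rw (mult_unit_r (bmonad H) (H a)).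
  + rw (eq_sym (mult_natural (δ a))).
    rw (mult_assoc (bmonad H) (H a)).
    rw (fmap_eq H (eq_sym (naturality S (δ a)))).
    rw (fmap_eq H (eq_sym (comult_coassoc (bcomonad H) a))).
    rw (fmap_eq H (SL (H a))).
    rw (fmap_eq H (comult_counit_l (bcomonad H) a)).
    now rw (mult_unit_r (bmonad H) (H a)).
Qed.

(** The candidate [x ↦ (ε ⊗ 1)(γ⁻¹(x ⊗ 1))] is an antipode because [γ⁻¹] is
    right [H]-linear and left [H]-colinear. *)
Lemma antipode_of_gamma_iso : is_natural_iso (gamma H) -> has_antipode H.
Proof.
intros [β [βγ γβ]]; cbn in βγ, γβ.
assert (linear : forall a, β a ∘ fmap H (m a) = fmap H (m a) ∘ β (H a)).
{ intros a; apply (inverse_intertwines (βγ a) (γβ (H a))); nf.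
  rw (comult_natural (m a)).
  now rw (fmap_eq H (eq_sym (mult_assoc (bmonad H) a))). }
assert (colinear : forall a, fmap H (β a) ∘ δ (H a) = δ (H a) ∘ β a).
{ intros a.
  pose proof (eq_trans (fmap_eq H (βγ a)) (fmap_id H _)) as Hβγ.
  apply (inverse_intertwines Hβγ (γβ a)); nf.
  rw (comult_natural (m a)).
  now rw (comult_coassoc (bcomonad H) (H a)). }
assert (β_unit : forall a, β a ∘ δ a = fmap H (e a)).
{ intros a.
  rewrite <- (comp_idl (fmap H (e a))).
  rewrite <- (βγ a); nf.
  rw (comult_natural (e a)).
  now rw (fmap_eq H (mult_unit_r (bmonad H) a)). }
assert (counit_β : forall a, m a ∘ β a = ε (H a)).
{ intros a.
  rewrite <- (comp_idr (ε (H a))).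
  rewrite <- (γβ a); nf.
  rw (counit_natural (m a)).
  now rw (comult_counit_l (bcomonad H) (H a)). }
unshelve eexists.
- exists (fun a => ε (H a) ∘ β a ∘ fmap H (e a)).
  intros a b f; nf.
  rw (fmap_eq H (unit_natural f)).
  rw (naturality β f).
  now rw (counit_natural (fmap H f)).
- split; intros a; nf.
  + rw (eq_sym (counit_natural (m a))).
    rw (eq_sym (linear a)).
    rw (fmap_eq H (mult_unit_l (bmonad H) a)).
    rw (β_unit a).
    now rw (counit_natural (e a)).
  + rw (eq_sym (comult_natural (e a))).
    rw (colinear a).
    rw (comult_counit_r (bcomonad H) (H a)).
    rw (counit_β a).
    now rw (counit_natural (e a)).
Qed.

(** The candidate [x ↦ (1 ⊗ ε)(γ'⁻¹(1 ⊗ x))] is an antipode because [γ'⁻¹] is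
    left [H]-linear and right [H]-colinear. *)
Lemma antipode_of_gamma'_iso : is_natural_iso (gamma' H) -> has_antipode H.
Proof.
intros [β [βγ γβ]]; cbn in βγ, γβ.
assert (linear : forall a, β a ∘ m (H a) = m (H a) ∘ fmap H (β a)).
{ intros a.
  pose proof (eq_trans (fmap_eq H (γβ a)) (fmap_id H _)) as Hγβ.
  apply (inverse_intertwines (βγ a) Hγβ); nf.
  rw (eq_sym (mult_natural (δ a))).
  now rw (mult_assoc (bmonad H) (H a)). }
assert (colinear : forall a, β (H a) ∘ fmap H (δ a) = fmap H (δ a) ∘ β a).
{ intros a; apply (inverse_intertwines (βγ (H a)) (γβ a)); nf.
  rw (eq_sym (mult_natural (δ a))).
  now rw (fmap_eq H (comult_coassoc (bcomonad H) a)). }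
assert (β_counit : forall a, m a ∘ β a = fmap H (ε a)).
{ intros a.
  rewrite <- (comp_idr (fmap H (ε a))).
  rewrite <- (γβ a); nf.
  rw (eq_sym (mult_natural (ε a))).
  now rw (fmap_eq H (comult_counit_r (bcomonad H) a)). }
assert (unit_β : forall a, β a ∘ δ a = e (H a)).
{ intros a.
  rewrite <- (comp_idl (e (H a))).
  rewrite <- (βγ a); nf.
  rw (eq_sym (unit_natural (δ a))).
  now rw (mult_unit_l (bmonad H) (H a)). }
unshelve eexists.
- exists (fun a => fmap H (ε a) ∘ β a ∘ e (H a)).
  intros a b f; nf.
  rw (unit_natural (fmap H f)).
  rw (naturality β f).
  now rw (fmap_eq H (counit_natural f)).
- split; intros a; nf.
  + rw (unit_natural (δ a)).
    rw (colinear a).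
    rw (fmap_eq H (comult_counit_l (bcomonad H) a)).
    rw (β_counit a).
    now rw (eq_sym (unit_natural (ε a))).
  + rw (mult_natural (ε a)).
    rw (eq_sym (linear a)).
    rw (mult_unit_r (bmonad H) (H a)).
    rw (unit_β a).
    now rw (eq_sym (unit_natural (ε a))).
Qed.

(** * Coinvariants and the comparison functor *)

(** Evaluate the compatibility of [δ] and [m] at the unit of the inner
    factor. *)
Lemma entwining_of_unit (a : A) : λ a ∘ fmap H (e a) = δ a.
Proof.
symmetry.
rewrite <- (comp_idr (δ a)), <- (mult_unit_r (bmonad H) a).
nf; rw (bimonad_comult_mult H a).
rw (fmap_eq H (bimonad_comult_unit H a)).
rw (fmap_eq H (unit_natural (e a))).
rw (naturality λ (e a)).
now rw (fmap_eq H (mult_unit_r (bmonad H) a)).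
Qed.

(** [e b] is the equaliser of [δ b] and [e (H b)], with retraction [ε b]. *)
Lemma coinvariant_factors_through_unit {a b : A} {x : hom a (H b)} :
  δ b ∘ x = e (H b) ∘ x -> e b ∘ (ε b ∘ x) = x.
Proof.
intros E.
rw (unit_natural (ε b)).
rw (eq_sym E).
now rw (comult_counit_r (bcomonad H) b).
Qed.

Lemma mixed_hom_coinvariant {a : A} {M : MixedModule H}
    (g : MixedHom (comparison_ob H a) M) :
  coaction M ∘ (g ∘ e a) = e M ∘ (g ∘ e a).
Proof.
rw (underlying_coaction g).
rw (bimonad_comult_unit H a).
now rw (unit_natural g).
Qed.

(** [H a] is the free module on [a]. *)
Lemma mixed_hom_of_unit {a : A} {M : MixedModule H}
    (g : MixedHom (comparison_ob H a) M) :
  action M ∘ fmap H (g ∘ e a) = g.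
Proof.
nf.
rw (eq_sym (underlying_action g)).
now rw (mult_unit_r (bmonad H) a).
Qed.

Lemma free_extension_unit {a : A} {M : MixedModule H} (f : hom a M) :
  action M ∘ fmap H f ∘ e a = f.
Proof.
nf.
rw (eq_sym (unit_natural f)).
now rw (action_unit M).
Qed.

Lemma fully_faithful_comparison : fully_faithful (comparison H).
Proof.
intros a b g.
change (MixedHom (comparison_ob H a) (comparison_ob H b)) in g.
exists (ε b ∘ (g ∘ e a)); split.
- apply mixed_hom_eq; cbn.
  (* [E] writes [g ∘ e a] as [e b ∘ f], so [g], its free extension, is
     [m b ∘ H (e b) ∘ H f = H f]. *)
  pose proof (coinvariant_factors_through_unit (mixed_hom_coinvariant g)) as E.
  refine (eq_trans _ (mixed_hom_of_unit g)).
  refine (eq_trans _ (f_equal (fun x => m b ∘ fmap H x) E)); nf.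
  now rw (mult_unit_r (bmonad H) b).
- intros f <-; cbn.
  rw (eq_sym (unit_natural f)).
  now rw (bimonad_counit_unit H b).
Qed.

(** The module morphism [H a -> M] that extends [f] is colinear because
    [λ ∘ H e = δ]. *)
Lemma free_extension_colinear {a : A} {M : MixedModule H} {f : hom a M} :
  coaction M ∘ f = e M ∘ f ->
  coaction M ∘ (action M ∘ fmap H f) = fmap H (action M ∘ fmap H f) ∘ δ a.
Proof.
intros E; nf.
rw (mixed_compat M).
rw (fmap_eq H E).
rw (entwining_of_unit M).
now rw (comult_natural f).
Qed.

Lemma free_extension_linear {a : A} {M : MixedModule H} (f : hom a M) :
  (action M ∘ fmap H f) ∘ m a = action M ∘ fmap H (action M ∘ fmap H f).
Proof.
nf.
rw (eq_sym (mult_natural f)).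
now rw (action_assoc M).
Qed.

Definition free_extension {a : A} {M : MixedModule H} {f : hom a M}
    (E : coaction M ∘ f = e M ∘ f) : MixedHom (comparison_ob H a) M :=
  @Build_MixedHom _ _ (comparison_ob H a) M (action M ∘ fmap H f)
    (free_extension_linear f) (free_extension_colinear E).

End Bimonads.

(** * Right adjoints from universal arrows *)

Definition is_universal_from {C D : Category} {L : Functor C D} {d : D}
    {r : C} (c : hom (L r) d) : Prop :=
  forall (x : C) (g : hom (L x) d), exists! f : hom x r, c ∘ fmap L f = g.

Lemma right_adjoint_of_universal {C D : Category} (L : Functor C D) :
  (forall d, exists r (c : hom (L r) d), is_universal_from c) ->
  has_right_adjoint L.
Proof.
intros U.
set (r d := proj1_sig (constructive_indefinite_description _ (U d))).
set (V d := proj2_sig (constructive_indefinite_description _ (U d))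
            : exists c : hom (L (r d)) d, is_universal_from c).
set (c d := proj1_sig (constructive_indefinite_description _ (V d))).
assert (W : forall d, is_universal_from (c d))
  by exact (fun d => proj2_sig (constructive_indefinite_description _ (V d))).
(* Only the universal property of the chosen arrows matters from here on. *)
clearbody c; clear V; clearbody r.
set (t d x (g : hom (L x) d) :=
       proj1_sig (constructive_indefinite_description _ (W d x g))).
assert (tE : forall d x (g : hom (L x) d), c d ∘ fmap L (t d x g) = g)
  by exact (fun d x g => proj1
       (proj2_sig (constructive_indefinite_description _ (W d x g)))).
assert (t_unique : forall d x (f f' : hom x (r d)),
  c d ∘ fmap L f = c d ∘ fmap L f' -> f = f').
{ intros d x f f' E.
  destruct (W d x (c d ∘ fmap L f')) as [f0 [_ F]].
  now rewrite <- (F f E), <- (F f' eq_refl). }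
clearbody t.
unshelve eexists.
- exists r (fun d d' k => t d' (r d) (k ∘ c d)).
  + intros d; apply t_unique.
    now rewrite tE, fmap_id, comp_idl, comp_idr.
  + intros d d' d'' k' k; apply t_unique.
    now rewrite tE, fmap_comp, comp_assoc, tE, <- !comp_assoc, tE.
- constructor.
  unshelve eexists.
  + exists (fun x => t (L x) x (idm (L x))).
    intros x y f; apply t_unique; cbn.
    now rewrite !fmap_comp, !comp_assoc, !tE, <- comp_assoc, tE,
      comp_idl, comp_idr.
  + exists c.
    intros d d' k; cbn; apply tE.
  + intros x; cbn; apply tE.
  + intros d; apply t_unique; cbn.
    now rewrite fmap_comp, comp_assoc, tE, <- comp_assoc, tE, fmap_id.
Qed.

(** The universal arrow to [M] is the free extension of the inclusion of the
    coinvariants, the equaliser of the coaction and the unit. *)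
Lemma comparison_has_right_adjoint {A : Category} {H : Bimonad A} :
  has_equalisers A -> has_right_adjoint (comparison H).
Proof.
intros Q; apply right_adjoint_of_universal; intros M.
destruct (Q _ _ (coaction M) (unit (bmonad H) M)) as [q [i [E U]]].
exists q, (free_extension E).
intros x g.
destruct (U x _ (mixed_hom_coinvariant g)) as [y [Ey Uy]].
exists y; split.
- apply mixed_hom_eq; cbn.
  rewrite <- (mixed_hom_of_unit g), <- Ey.
  now nf.
- intros y' E'; apply Uy.
  rewrite <- E'; cbn.
  rewrite <- (free_extension_unit (i ∘ y')).
  now nf.
Qed.

Theorem mainTheorem2 (A : Category) (H : Bimonad A) :
  ((is_natural_iso (gamma H) <-> is_natural_iso (gamma' H)) /\
   (is_natural_iso (gamma' H) <-> has_antipode H)) /\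
  (has_antipode H -> has_equalisers A -> makes_coreflective (comparison H)).
Proof.
split; [split; split|].
- intros G; exact (gamma'_iso_of_antipode (antipode_of_gamma_iso G)).
- intros G; exact (gamma_iso_of_antipode (antipode_of_gamma'_iso G)).
- exact antipode_of_gamma'_iso.
- exact gamma'_iso_of_antipode.
- intros _ Q; split.
  + exact fully_faithful_comparison.
  + exact (comparison_has_right_adjoint Q).
Qed.
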